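(* Let $F$ be an infinite field of characteristic $3$, let $A=F[x_1,\dots,x_m]/(x_1^2,\dots,x_m^2)$ with homogeneous components $A_j$, let $U\subseteq A_1$ be a subspace with $\dim U=n\ge 1$, and let $k\ge 0$ be an integer. (A) If $\mathrm{ms}_i(U)\ge 4i-2+2k$ for all $1\le i\le n$, then $\{f\in A_k: fw=0\ \forall w\in U^{2n}\}=A_k\cap \mathrm{Im}(U)$. (B) If $\mathrm{ms}_i(U)\ge 4i-3+2k$ for all $1\le i\le n$, then $\{f\in A_{2n-2+k}: fu=0\ \forall u\in U\}=A_{2n-2+k}\cap \mathrm{Im}(U^{2n})$.
   Context: $A$ is graded by degree; elements of $A_1$ are linear forms. For a linear form $u=\sum_i c_ix_i$, $\mathrm{supp}(u)=\{x_i:c_i\ne0\}$; for a subspace $V\subseteq A_1$, $\mathrm{supp}(V)=\bigcup_{v\in V}\mathrm{supp}(v)$, and for $1\le i\le \dim U$, $\mathrm{ms}_i(U)=\min\{|\mathrm{supp}(V)|: V\subseteq U\text{ a subspace}, \dim V=i\}$. For subspaces $W\subseteq A_a$, $W'\subseteq A_b$, $WW'$ is the subspace of $A_{a+b}$ spanned by products $ww'$; $U^{2n}$ is the subspace of $A_{2n}$ spanned by all products of $2n$ elements of $U$. For a subspace $W$ of $A$, $\mathrm{Im}(W)$ denotes the ideal of $A$ generated by $W$. *)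

(* Defs.v *)
From HB Require Import structures.
From mathcomp Require Import all_boot all_algebra.
From mathcomp Require Import boolp.
Set Implicit Arguments. Unset Strict Implicit. Unset Printing Implicit Defensive.
Import GRing.Theory.
Local Open Scope ring_scope.

(* A = F[x_1..x_m]/(x_1^2,..,x_m^2), represented in its monomial basis:
   an element is the family of coefficients f S of the squarefree monomial
   x_S = prod_{j in S} x_j, S a subset of 'I_m. *)
Notation alg F m := {ffun {set 'I_m} -> F^o}.

Section Alg.
Variables (F : fieldType) (m : nat).

(* product: x_S * x_T = x_(S u T) if S, T disjoint, 0 otherwise *)
Definition amul (f g : alg F m) : alg F m :=
  [ffun T : {set 'I_m} => \sum_(S : {set 'I_m} | S \subset T) f S * g (T :\: S)].

Definition aone : alg F m := [ffun S => (S == set0)%:R].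

Definition homog (k : nat) (f : alg F m) : Prop :=
  forall S, f S != 0 -> #|S| = k.

Definition supp (V : {vspace alg F m}) : {set 'I_m} :=
  [set j : 'I_m | `[< exists v, v \in V /\ v [set j] != 0 >]].

(* ms_i(U) = min { |supp V| : V <= U subspace, dim V = i }  (values are <= m;
   if no such V exists, which only happens for i > dim U, the value is m.+1) *)
Definition ms (U : {vspace alg F m}) (i : nat) : nat :=
  find (fun s => `[< exists V : {vspace alg F m},
                        [/\ (V <= U)%VS, \dim V = i & #|supp V| = s] >])
       (iota 0 m.+1).

Definition inpow (U : {vspace alg F m}) (N : nat) (w : alg F m) : Prop :=
  exists s : seq (F * N.-tuple (alg F m)),
    (forall p, p \in s -> all (fun u => u \in U) p.2) /\
    w = \sum_(p <- s) p.1 *: foldr amul aone p.2.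

Definition inIdeal (W : alg F m -> Prop) (f : alg F m) : Prop :=
  exists s : seq (alg F m * alg F m),
    (forall p, p \in s -> W p.2) /\ f = \sum_(p <- s) amul p.1 p.2.

End Alg.

(* Main.v *)
(* In characteristic 3 every linear form has cube zero, so for a basis X of U
   the space U^(2n) is spanned by w_U = prod_(u in X) u^2.  Fix a variable x, let
   A = N[x]/(x^2), let U0 be the projection of U to N and let U' be the hyperplane
   of U where x does not occur.  Comparing coefficients of x,
   - (A) for U in degree k follows from (B) for U0 in degree k and (A) for U';
   - (B) for U in degree k follows from (B) for U' in degree k + 1 and (A) for U0
     in degree k - 1, provided the bound on ms for U' gains about 4 over the one
     for U.
   The gain holds when U' = H is the kernel in U of a functional gam that vanishes
   on none of the finitely many nonzero subspaces {u in U : supp u in S}: then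
   ms_i(H) >= ms_(i+1)(U).  For general U, (B) for such an H writes an f killed by
   U as w_H g, and g is controlled by exchanging the coordinate functional of
   some variable x for gam, which brings us back to the good case. *)
Require Import Defs.
From HB Require Import structures.
From mathcomp Require Import all_boot all_algebra.
From mathcomp Require Import boolp.
From mathcomp Require Import zify ring.
Import GRing.Theory.
Local Open Scope ring_scope.
Set Implicit Arguments. Unset Strict Implicit. Unset Printing Implicit Defensive.

(** * The squarefree algebra as a commutative [F]-algebra *)

Section Ring.
Variables (F : fieldType) (m : nat).
Implicit Types (f g h : alg F m) (S T R : {set 'I_m}).

Lemma amulC f g : amul f g = amul g f.
Proof.
apply/ffunP=> T; rewrite !ffunE (reindex_onto (fun S => T :\: S) (fun S => T :\: S)) /=.
  by apply: eq_big => [S|S /andP[_ /eqP->]]; rewrite ?subsetDl ?andTb /= 1?mulrC //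
     setDDr setDv set0U; apply/eqP/setIidPr.
by move=> S /setIidPr sST; rewrite setDDr setDv set0U.
Qed.

Lemma amulA f g h : amul f (amul g h) = amul (amul f g) h.
Proof.
apply/ffunP=> T; rewrite !ffunE.
under eq_bigr do rewrite ffunE mulr_sumr.
under [RHS]eq_bigr do rewrite ffunE mulr_suml.
rewrite [RHS](exchange_big_dep (fun R => R \subset T)) /=; last first.
  by move=> S R sST sRS; apply: subset_trans sST.
apply: eq_bigr => R sRT.
rewrite [RHS](reindex_onto (fun Q => R :|: Q) (fun S => S :\: R)) /=; last first.
  by move=> S /andP[_ sRS]; rewrite -{1}(setIidPr sRS) setID.
apply: eq_big => [Q|Q]; last first.
  rewrite subsetD => /andP[sQT dQR].
  rewrite setDUl setDv set0U (setDidPl dQR) setDDl mulrA //.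
rewrite subUset sRT subsetUl andbT setDUl setDv set0U subsetD /=.
by congr (_ && _); apply/idP/eqP => /setDidPl.
Qed.

Lemma amul1 f : amul (aone F m) f = f.
Proof.
apply/ffunP=> T; rewrite ffunE (bigD1 set0) ?sub0set //= ffunE eqxx mul1r setD0.
by rewrite big1 ?addr0 // => S /andP[_ /negPf n0]; rewrite ffunE n0 mul0r.
Qed.

Lemma amulDl f g h : amul (f + g) h = amul f h + amul g h.
Proof.
apply/ffunP=> T; rewrite !ffunE -big_split /=.
by apply: eq_bigr => S _; rewrite !ffunE mulrDl.
Qed.

Lemma aone_neq0 : aone F m != 0.
Proof.
by apply/eqP => /ffunP/(_ set0); rewrite !ffunE eqxx => /eqP; rewrite oner_eq0.
Qed.

(* The pointwise product is already the canonical ring structure on finite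
   functions, hence the alias. *)
Definition sqfree : Type := alg F m.
HB.instance Definition _ := GRing.Lmodule.copy sqfree (alg F m).
HB.instance Definition _ := GRing.Zmodule_isComNzRing.Build sqfree
  amulA amulC amul1 amulDl aone_neq0.

Lemma sqfree_scaleAl (a : F) (f g : sqfree) : a *: (f * g) = (a *: f) * g.
Proof.
apply/ffunP=> T; rewrite !ffunE scaler_sumr.
by apply: eq_bigr => S _; rewrite ffunE -scalerAl.
Qed.

HB.instance Definition _ :=
  GRing.LSemiModule_isLSemiAlgebra.Build F sqfree sqfree_scaleAl.
HB.instance Definition _ := GRing.LSemiAlgebra_isComSemiAlgebra.Build F sqfree.

End Ring.

(** * Coefficients with respect to one variable, and degree bounds *)

Section Coordinates.
Variables (F : fieldType) (m : nat).
Local Notation A := (sqfree F m).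
Implicit Types (f g h : A) (S T : {set 'I_m}) (i j : 'I_m) (k : nat).

Lemma mulE f g T : (f * g) T = \sum_(S : {set 'I_m} | S \subset T) f S * g (T :\: S).
Proof. by rewrite ffunE. Qed.

Definition var j : A := [ffun S : {set 'I_m} => (S == [set j])%:R].

(* With [A = N[x_j]/(x_j^2)]: [f = sigma j f + var j * del j f], both coefficients in [N]. *)
Definition sigma j f : A := [ffun S : {set 'I_m} => if j \in S then 0 else f S].

Definition del j f : A := [ffun S : {set 'I_m} => if j \in S then 0 else f (j |: S)].

Fact sigma_linear j : linear (sigma j).
Proof. by move=> a f g; apply/ffunP=> S; rewrite !ffunE; case: ifP; rewrite ?scaler0 ?addr0. Qed.
HB.instance Definition _ j := GRing.isLinear.Build F A A *:%R (sigma j) (sigma_linear j).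

Fact del_linear j : linear (del j).
Proof. by move=> a f g; apply/ffunP=> S; rewrite !ffunE; case: ifP; rewrite ?scaler0 ?addr0. Qed.
HB.instance Definition _ j := GRing.isLinear.Build F A A *:%R (del j) (del_linear j).

Lemma sigmaM j f g : sigma j (f * g) = sigma j f * sigma j g.
Proof.
apply/ffunP=> T; rewrite ffunE !mulE; case: ifPn => jT.
  rewrite big1 // => S sST; rewrite !ffunE inE jT andbT.
  by case: (j \in S); rewrite ?mul0r ?mulr0.
apply: eq_bigr => S sST; rewrite !ffunE inE (negPf jT) andbF.
by rewrite (contraNF (subsetP sST j) jT).
Qed.

(** Since [var j ^+ 2 = 0], exactly one of the two factors supplies [var j]: [del j] is a derivation
    relative to the ring morphism [sigma j]. *)
Lemma delM j f g : del j (f * g) = sigma j f * del j g + del j f * sigma j g.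
Proof.
apply/ffunP=> T; rewrite ffunE !mulE [RHS]ffunE !mulE; case: ifPn => jT.
  rewrite !big1 ?addr0 // => S sST; rewrite !ffunE inE jT andbT.
    by case: (j \in S); rewrite ?mul0r ?mulr0.
  by case: (j \in S); rewrite ?mul0r ?mulr0.
rewrite (bigID (fun S => j \in S)) /= addrC; congr (_ + _).
  apply: eq_big => [S|S /andP[sST jS]].
    by rewrite -subsetD1 setU1K.
  have dS : j \notin S by [].
  rewrite !ffunE (negPf jS) inE (negPf jT) andbF; congr (_ * g _).
  by apply/setP => i; rewrite !inE; case: eqVneq => [->|]; rewrite ?jS ?jT.
rewrite (reindex_onto (fun S => j |: S) (fun S => S :\ j)) /=; last first.
  by move=> S /andP[_ jS]; rewrite setD1K.
apply: eq_big => [S|S].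
  rewrite setU11 andbT subUset sub1set setU11 /=.
  have [jS|jS] := boolP (j \in S).
    rewrite (contraNF (fun s => subsetP s j jS) jT) andbC.
    by case: eqP => // /setP/(_ j); rewrite !inE eqxx jS.
  rewrite setU1K // eqxx andbT.
  apply/idP/idP => [/subsetP sS|sS]; last by rewrite (subset_trans sS) ?subsetUr.
  by apply/subsetP => i iS; have := sS i iS; rewrite !inE; case: eqP iS => // ->; rewrite (negPf jS).
rewrite setU11 andbT => /andP[_ /eqP defS].
have jS : j \notin S by rewrite -defS !inE eqxx.
rewrite !ffunE (negPf jS) inE (negPf jT) andbF; congr (_ * g _).
by apply/setP => i; rewrite !inE; case: eqVneq => [->|]; rewrite ?(negPf jT) ?andbF ?orbF.
Qed.

Lemma mul_varE j f T : (var j * f) T = if j \in T then f (T :\ j) else 0.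
Proof.
rewrite mulE; case: ifPn => jT.
  rewrite (bigD1 [set j]) ?sub1set //= ffunE eqxx mul1r big1 ?addr0 //.
  by move=> S /andP[_ /negPf nS]; rewrite ffunE nS mul0r.
rewrite big1 // => S sST; rewrite ffunE; case: eqP => [defS|]; rewrite ?mul0r //.
by rewrite defS sub1set (negPf jT) in sST.
Qed.

Lemma sigma_del j f : f = sigma j f + var j * del j f.
Proof.
apply/ffunP=> T; rewrite ffunE mul_varE !ffunE; case: ifPn => jT; rewrite ?addr0 //.
by rewrite !inE eqxx /= add0r setD1K.
Qed.

Lemma var_sq j : var j ^+ 2 = 0.
Proof.
apply/ffunP=> T; rewrite expr2 mul_varE [RHS]ffunE; case: ifP => // jT; rewrite ffunE.
by case: eqP => // /setP/(_ j); rewrite !inE eqxx.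
Qed.

Lemma sigma_var i j : sigma j (var i) = if i == j then 0 else var i.
Proof.
apply/ffunP=> T; rewrite ffunE; case: eqVneq => [->|ij]; rewrite !ffunE.
  by case: ifP => // jT; case: eqP => // defT; rewrite defT set11 in jT.
by case: ifP => // jT; case: eqP => // defT; rewrite defT inE eq_sym (negPf ij) in jT.
Qed.

Lemma del_var i j : del j (var i) = if i == j then 1 else 0.
Proof.
apply/ffunP=> T; rewrite ffunE; case: eqVneq => [->|ij]; rewrite !ffunE.
  case: ifPn => jT; first by case: eqP => // T0; rewrite T0 inE in jT.
  congr (_%:R); congr nat_of_bool; apply/eqP/eqP => [e|->]; last by rewrite setU0.
  by rewrite -(setU1K jT) e setDv.
case: ifPn => // jT; case: eqP => // /setP/(_ j); rewrite !inE eqxx eq_sym.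
by rewrite (negPf ij).
Qed.

Lemma sigma1 j : sigma j 1 = 1.
Proof.
apply/ffunP=> T; rewrite !ffunE; case: ifP => // jT.
by case: eqP => // T0; rewrite T0 inE in jT.
Qed.

Lemma sigma_sigma j f : sigma j (sigma j f) = sigma j f.
Proof. by apply/ffunP=> T; rewrite !ffunE; case: (j \in T). Qed.

Lemma del_sigma j f : del j (sigma j f) = 0.
Proof. by apply/ffunP=> T; rewrite !ffunE setU11; case: (j \in T). Qed.

Lemma sigma_del_id j f : sigma j (del j f) = del j f.
Proof. by apply/ffunP=> T; rewrite !ffunE; case: (j \in T). Qed.

(** The strict inequality lets [degb 0] mean being zero, so that bounds such as [k.-1] and
    [d - 2 * n] stay meaningful when the subtraction truncates. *)
Definition degb k f := forall S, f S != 0 -> (#|S| < k)%N.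

Lemma degb0 k : degb k 0.
Proof. by move=> S; rewrite ffunE eqxx. Qed.

Lemma degb_eq0 f : degb 0 f -> f = 0.
Proof.
by move=> d; apply/ffunP=> S; rewrite [RHS]ffunE; apply/eqP/negbNE/negP => /d.
Qed.

Lemma degbW k k' f : (k <= k')%N -> degb k f -> degb k' f.
Proof. by move=> kk d S /d /leq_trans; apply. Qed.

Lemma degbD k f g : degb k f -> degb k g -> degb k (f + g).
Proof.
move=> df dg S; rewrite ffunE; have [f0|/df //] := eqVneq (f S) 0.
by rewrite f0 add0r => /dg.
Qed.

Lemma degbZ k (a : F) f : degb k f -> degb k (a *: f).
Proof. by move=> df S; rewrite ffunE scaler_eq0 negb_or => /andP[_ /df]. Qed.

Lemma degbN k f : degb k f -> degb k (- f).
Proof. by rewrite -scaleN1r; apply: degbZ. Qed.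

Lemma degbB k f g : degb k f -> degb k g -> degb k (f - g).
Proof. by move=> df dg; apply: degbD => //; apply: degbN. Qed.

Lemma degbM k k' f g : degb k f -> degb k'.+1 g -> degb (k + k') (f * g).
Proof.
move=> df dg T; apply: contraR; rewrite -leqNgt => kT; rewrite mulE.
apply/eqP/big1 => S sST; have [->|/df fS] := eqVneq (f S) 0; first by rewrite mul0r.
have [->|/dg gS] := eqVneq (g (T :\: S)) 0; first by rewrite mulr0.
have := cardsID S T; rewrite (setIidPr sST); lia.
Qed.

Lemma degb1 : degb 1 1.
Proof.
by move=> S; rewrite ffunE; have [->|] := eqVneq S set0; rewrite ?cards0 ?eqxx.
Qed.

Lemma degbX k f e : degb k.+1 f -> degb (k * e).+1 (f ^+ e).
Proof.
move=> df; elim: e => [|e IH]; first by rewrite muln0 expr0; exact: degb1.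
by rewrite exprSr mulnSr -addSn; apply: degbM.
Qed.

Lemma degb_var j : degb 2 (var j).
Proof.
move=> S; rewrite ffunE; have [->|] := eqVneq S [set j]; rewrite ?cards1 ?eqxx //.
Qed.

Lemma degb_sigma j k f : degb k f -> degb k (sigma j f).
Proof. by move=> df S; rewrite ffunE; case: ifP => [|_ /df]; rewrite ?eqxx. Qed.

Lemma degb_del j k f : degb k f -> degb k.-1 (del j f).
Proof.
move=> df S; rewrite ffunE; case: ifPn => [|jS /df]; rewrite ?eqxx //.
by rewrite cardsU1 jS; case: k {df}.
Qed.

Lemma degb_mul1 k f g : degb 2 g -> degb k.-1 f -> degb k (g * f).
Proof.
move=> dg; case: k => [|k] df; first by rewrite (degb_eq0 df) mulr0; apply: degb0.
by rewrite mulrC -addn1; apply: degbM.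
Qed.

End Coordinates.

(** * Functionals that are nonzero at finitely many given vectors, over an infinite field *)

Section Generic.
Variables (F : fieldType) (vT : vectType F).
Hypothesis hinf : forall s : seq F, exists x, x \notin s.

Lemma exists_functional (v : vT) : v != 0 -> exists c : 'Hom(vT, F^o), c v != 0.
Proof.
move=> v0; have [/existsP[i ci]|] :=
  boolP [exists i, coord (vbasis fullv) i v != 0].
  by exists (linfun (coord (vbasis fullv) i : vT -> F^o)); rewrite lfunE.
rewrite negb_exists => /forallP v_i; case/eqP: v0.
rewrite (coord_vbasis (memvf v)) big1 // => i _.
by have:= v_i i; rewrite negbK => /eqP->; rewrite scale0r.
Qed.

Lemma exists_generic_functional (s : seq vT) :
  (forall v, v \in s -> v != 0) ->
  exists c : 'Hom(vT, F^o), forall v, v \in s -> c v != 0.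
Proof.
elim: s => [|v s IH] ns; first by exists 0.
have [|c cs] := IH; first by move=> w ws; apply: ns; rewrite inE ws orbT.
have [c' c'v] := exists_functional (ns v (mem_head _ _)).
(* If [c v = 0], then [c' + t *: c] takes the value [c' v] at [v], and [t] avoids the ratios for
   which it would vanish at an element of [s]. *)
have [t] := hinf (0 :: [seq - c' w / c w | w <- v :: s]).
rewrite inE negb_or => /andP[t0 ts].
have [cv|cv] := eqVneq (c v) 0.
  exists (c' + t *: c) => w; rewrite inE !lfunE /= !lfunE /=.
  case/orP=> [/eqP->|ws]; first by rewrite cv scaler0 addr0.
  apply: contraNneq ts => e; apply/mapP; exists w; first by rewrite inE ws orbT.
  apply: (mulIf (cs w ws)); rewrite divfK ?cs //.
  by apply/eqP; rewrite -subr_eq0 opprK addrC; apply/eqP.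
by exists c => w; rewrite inE => /orP[/eqP->|/cs].
Qed.

End Generic.

(** * Parametrized linear forms in characteristic 3 and products of their squares *)

Section LinearForms.
Variables (F : fieldType) (m : nat) (vT : vectType F).
Hypothesis hchar : 3 \in [pchar F].
Local Notation A := (sqfree F m).
Local Notation columns := ('I_m -> 'Hom(vT, F^o)).
Implicit Types (f g h : A) (c : columns) (u v y : vT) (U V : {vspace vT})
  (X Y : seq vT) (i j : 'I_m) (gam : 'Hom(vT, F^o)).

Lemma natr3 : 3%:R = 0 :> A.
Proof. by rewrite -scaler_nat (pcharf0 hchar) scale0r. Qed.

(** The parameter space [vT] is fixed while the functionals [c i] vary: projecting along a variable,
    or exchanging a coordinate for another functional, only changes one column, and [lin c] may
    cease to be injective. *)
Definition lin c v : A := \sum_i (c i v : F) *: var F i.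

Fact lin_linear c : linear (lin c).
Proof.
move=> a u v; rewrite /lin scaler_sumr -big_split /=; apply: eq_bigr => i _.
by rewrite linearP scalerDl scalerA.
Qed.
HB.instance Definition _ c := GRing.isLinear.Build F vT A *:%R (lin c) (lin_linear c).

Definition set_col c j gam : columns :=
  fun i => if i == j then gam else c i.

Lemma lin_set_col c j gam v :
  lin (set_col c j gam) v = lin (set_col c j 0) v + (gam v : F) *: var F j.
Proof.
rewrite /lin (bigD1 j) //= [in RHS](bigD1 j) //= /set_col eqxx lfunE /= scale0r add0r.
rewrite addrC; congr (_ + _); apply: eq_bigr => i /negPf ij.
by rewrite ij.
Qed.

Lemma sigma_lin c j v : sigma j (lin c v) = lin (set_col c j 0) v.
Proof.
rewrite /lin linear_sum; apply: eq_bigr => i _; rewrite linearZ /= sigma_var /set_col.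
by case: ifP => // _; rewrite scaler0 lfunE scale0r.
Qed.

Lemma del_lin c j v : del j (lin c v) = (c j v : F) *: 1.
Proof.
rewrite /lin linear_sum (bigD1 j) //= linearZ /= del_var eqxx big1 ?addr0 //.
by move=> i /negPf ij; rewrite linearZ /= del_var ij scaler0.
Qed.

Lemma lin_set_col_id c j gam v : c j v = gam v -> lin (set_col c j gam) v = lin c v.
Proof.
move=> e; apply: eq_bigr => i _; rewrite /set_col.
by case: eqP => // ->; rewrite e.
Qed.

Lemma cubeD f g : (f + g) ^+ 3 = f ^+ 3 + g ^+ 3.
Proof.
have -> : (f + g) ^+ 3 = f ^+ 3 + g ^+ 3 + 3%:R * (f ^+ 2 * g + f * g ^+ 2) by ring.
by rewrite natr3 mul0r addr0.
Qed.

(** Cubing is additive in characteristic 3, and it kills each variable. *)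
Lemma lin_cube c v : lin c v ^+ 3 = 0.
Proof.
rewrite /lin; elim/big_rec: _ => [|i f _ f3]; first by rewrite expr0n.
by rewrite cubeD f3 addr0 exprZn (exprSr (var F i)) var_sq mul0r scaler0.
Qed.

Lemma degb_lin c v : degb 2 (lin c v).
Proof.
rewrite /lin; elim/big_rec: _ => [|i f _ f2]; first exact: degb0.
by apply: degbD => //; apply/degbZ/degb_var.
Qed.

Definition sqprod c X : A := \prod_(v <- X) lin c v ^+ 2.

Lemma sqprod_cons c v X : sqprod c (v :: X) = lin c v ^+ 2 * sqprod c X.
Proof. by rewrite /sqprod big_cons. Qed.

Lemma degb_sqprod c X : degb (2 * size X).+1 (sqprod c X).
Proof.
elim: X => [|v X IH]; first by rewrite /sqprod big_nil; exact: degb1.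
rewrite sqprod_cons mulnS -addSn; apply: degbM => //.
exact: (@degbX _ _ 1 _ 2 (@degb_lin c v)).
Qed.

Lemma sigma_sqprod c j X : sigma j (sqprod c X) = sqprod (set_col c j 0) X.
Proof.
elim: X => [|v X IH]; first by rewrite /sqprod !big_nil sigma1.
by rewrite !sqprod_cons !expr2 !sigmaM IH sigma_lin.
Qed.

Lemma sqprod_set_col c j gam X :
  {in X, forall v, c j v = gam v} -> sqprod (set_col c j gam) X = sqprod c X.
Proof.
move=> e; apply: eq_big_seq => v vX; congr (_ ^+ 2).
by apply: lin_set_col_id; apply: e.
Qed.

(** When [v] is expanded on [X], each term contains the cube of a form. *)
Lemma sqprod_lin0 c X v : v \in <<X>>%VS -> sqprod c X * lin c v = 0.
Proof.
move=> vX; rewrite (coord_span (X := in_tuple X) vX) linear_sum mulr_sumr big1 // => i _.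
rewrite linearZ /= -scalerAr; set y := _`_i.
have yX : y \in X by rewrite mem_nth.
rewrite /sqprod (big_rem y) //= mulrAC -exprSr lin_cube mul0r scaler0 //.
Qed.

(** The ideal generated by the forms [lin c v], with a degree bound on all cofactors; this bound
    becomes the degree bound on the quotient in (B). *)
Inductive lin_ideal c U k : A -> Prop :=
| lin_ideal0 : lin_ideal c U k 0
| lin_idealD v g f : v \in U -> degb k g -> lin_ideal c U k f ->
    lin_ideal c U k (lin c v * g + f).

Lemma lin_ideal_kill c U k f z : (forall v, v \in U -> z * lin c v = 0) ->
  lin_ideal c U k f -> z * f = 0.
Proof.
move=> zU; elim=> [|v g {}f vU _ _ IH]; first by rewrite mulr0.
by rewrite mulrDr IH mulrA zU // mul0r addr0.
Qed.

Lemma lin_idealW c U U' k f : (U <= U')%VS -> lin_ideal c U k f -> lin_ideal c U' k f.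
Proof.
by move=> sU; elim=> [|v g {}f vU ? _ IH]; constructor => //; apply: (subvP sU).
Qed.

Lemma lin_ideal_col c c' U k f : (forall v, v \in U -> lin c v = lin c' v) ->
  lin_ideal c U k f -> lin_ideal c' U k f.
Proof.
by move=> e; elim=> [|v g {}f vU ? _ IH]; [|rewrite e //]; constructor.
Qed.

Lemma lin_ideal_cons c u Y k f : lin_ideal c <<u :: Y>> k f ->
  exists g r, [/\ degb k g, lin_ideal c <<Y>> k r & f = lin c u * g + r].
Proof.
elim=> [|v g {}f]; first by exists 0, 0; split; [exact: degb0|constructor|rewrite mulr0 addr0].
rewrite span_cons => /memv_addP[_ /vlineP[a ->] [y yY ->]] dg _ [h [r [dh rY ->]]].
exists (a *: g + h), (lin c y * g + r); split; first by apply: degbD => //; apply: degbZ.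
  by constructor.
by rewrite linearD linearZ /= mulrDl mulrDr -scalerAl -scalerAr !addrA [X in X + r]addrAC.
Qed.

(** Modulo the cube of [lin c u], which is zero, the factor [lin c u ^+ 2] absorbs any change of the
    other vectors by multiples of [u]. *)
Lemma sqprod_shear c u (t : vT -> F) Y :
  lin c u ^+ 2 * \prod_(y <- Y) lin c (y - t y *: u) ^+ 2 =
  lin c u ^+ 2 * \prod_(y <- Y) lin c y ^+ 2.
Proof.
elim: Y => [|y Y IH]; first by rewrite !big_nil.
rewrite !big_cons [RHS]mulrCA -IH linearB linearZ /=.
move: (lin_cube c u); set l := lin c u; set w := lin c y; set P := \prod_(_ <- _) _.
move=> l3; rewrite -(mulr_algl (t y) l); set b := _%:A.
have -> : l ^+ 2 * ((w - b * l) ^+ 2 * P) =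
  w ^+ 2 * (l ^+ 2 * P) + l ^+ 3 * (b ^+ 2 * l - 2%:R * w * b) * P by ring.
by rewrite l3 !mul0r addr0.
Qed.

(** Some [x] in [X] has [gam x != 0]. Scaling it to [u] multiplies the product of squares by a
    nonzero square, and shearing the other vectors along [u] into the kernel of [gam] does not
    change it. *)
Lemma adapted_basis (gam : 'Hom(vT, F^o)) X :
  free X -> ~~ (<<X>> <= lker gam)%VS ->
  exists u Y (a : F),
    [/\ free (u :: Y), <<u :: Y>>%VS = <<X>>%VS, size X = (size Y).+1, gam u = 1 &
        (forall y, y \in Y -> gam y = 0) /\
        (a != 0 /\ forall c, sqprod c X = a *: sqprod c (u :: Y))].
Proof.
move=> fX nX.
have [x xX gx] : exists2 x, x \in X & gam x != 0.
  apply/hasP; apply: contraR nX => /hasPn nX; apply/span_subvP => x /nX.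
  by rewrite negbK memv_ker.
set X' := rem x X; have pX : perm_eq X (x :: X') by apply: perm_to_rem.
set u := (gam x : F)^-1 *: x; set Y := [seq y - (gam y : F) *: u | y <- X'].
have gu : gam u = 1 by rewrite linearZ; apply: mulVf.
have ux : u \in <<X>>%VS by rewrite memvZ // memv_span.
have spanE : <<u :: Y>>%VS = <<X>>%VS.
  rewrite (eq_span (perm_mem pX)); apply/eqP; rewrite eqEsubv; apply/andP; split.
    apply/span_subvP => v; rewrite inE => /orP[/eqP->|/mapP[y yX ->]].
      by rewrite memvZ // memv_span ?mem_head.
    by rewrite memvB ?memvZ ?memv_span ?mem_head // inE yX orbT.
  have uY : u \in <<u :: Y>>%VS by rewrite memv_span ?mem_head.
  apply/span_subvP => v; rewrite inE => /orP[/eqP->|yX].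
    have -> : x = (gam x : F) *: u by rewrite scalerA divff // scale1r.
    by rewrite memvZ.
  have -> : v = (v - (gam v : F) *: u) + (gam v : F) *: u by rewrite subrK.
  apply: memvD; last by apply: memvZ.
  rewrite memv_span // inE; apply/orP; right.
  by apply/mapP; exists v.
have sizeE : size X = (size Y).+1 by rewrite size_map (perm_size pX).
pose a : F := gam x.
exists u, Y, (a ^+ 2); split => //.
  by rewrite /free spanE /= -sizeE.
split=> [_ /mapP[y _ ->]|].
  by rewrite linearB linearZ /= gu; apply/eqP; rewrite subr_eq0 -[X in X == _]mulr1.
split=> [|c]; first by rewrite expf_neq0.
rewrite /sqprod (perm_big _ pX) /= !big_cons big_map.
have -> : lin c x = (gam x : F) *: lin c u by rewrite -linearZ scalerA divff // scale1r.
rewrite exprZn -scalerAl; congr (_ *: _).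
by rewrite sqprod_shear.
Qed.

End LinearForms.

(** * Supports of spaces of forms, and their change when a column is exchanged *)

Section Supports.
Variables (F : fieldType) (m : nat) (vT : vectType F).
Local Notation columns := ('I_m -> 'Hom(vT, F^o)).
Implicit Types (c : columns) (U V : {vspace vT}) (i j : 'I_m) (gam : 'Hom(vT, F^o)).

(** This is the support of the image of [V] under [lin c], read off from the columns. *)
Definition col_supp c V : {set 'I_m} := [set i | ~~ (V <= lker (c i))%VS].

Lemma col_supp_set_col c j gam V :
  (#|col_supp c V| <= #|col_supp (set_col c j gam) V|.+1)%N.
Proof.
apply: (leq_trans (n := #|j |: col_supp (set_col c j gam) V|)).
  apply/subset_leq_card/subsetP => i; rewrite !inE /set_col.
  by case: eqP.
by rewrite cardsU1; case: (_ \notin _); rewrite ?leqnSn.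
Qed.

Lemma col_supp_set_col_ge c j gam V :
  ((V <= lker gam)%VS -> (V <= lker (c j))%VS) ->
  (#|col_supp c V| <= #|col_supp (set_col c j gam) V|)%N.
Proof.
move=> h; apply/subset_leq_card/subsetP => i; rewrite !inE /set_col.
by case: eqP => // ->; apply: contra.
Qed.

Lemma col_supp_set_col_gt c j gam V :
  ~~ (V <= lker gam)%VS -> (V <= lker (c j))%VS ->
  (#|col_supp c V| < #|col_supp (set_col c j gam) V|)%N.
Proof.
move=> Vg Vj; apply/proper_card/properP; split.
  by apply/subsetP => i; rewrite !inE /set_col; case: eqP.
by exists j; rewrite !inE ?Vj // /set_col eqxx.
Qed.

(* The only subspaces to avoid are the {u in U : supp u in S}, one for each S. *)
Lemma generic_functional c U : (forall s : seq F, exists x, x \notin s) ->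
  exists gam, forall V, (V <= U)%VS -> V != 0%VS -> (V <= lker gam)%VS ->
  exists V', [/\ (V' <= U)%VS, V' != 0%VS, (\dim V < \dim V')%N &
                 (#|col_supp c V'| <= #|col_supp c V|)%N].
Proof.
move=> hinf; pose US (S : {set 'I_m}) := (U :&: \bigcap_(i in ~: S) lker (c i))%VS.
have [|gam hgam] := @exists_generic_functional F vT hinf
  [seq v <- [seq vpick (US T) | T : {set 'I_m} <- enum {set 'I_m}] | v != 0].
  by move=> v; rewrite mem_filter => /andP[].
exists gam => V VU V0 Vg; set S := col_supp c V.
have VS : (V <= US S)%VS.
  rewrite subv_cap VU; apply/subv_bigcapP => i.
  by rewrite !inE negbK.
have US0 : US S != 0%VS by apply: contraNneq V0 => e; rewrite -subv0 -e.
(* As [gam w != 0], [w] lies outside [V] but has its support in [S]: adding it to [V] raises the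
   dimension at no cost in variables. *)
set w := vpick (US S).
have w0 : w != 0 by rewrite vpick0.
have wUS : w \in US S by exact: memv_pick.
have gw : gam w != 0.
  by apply: hgam; rewrite mem_filter w0; apply/mapP; exists S; rewrite ?mem_enum.
have wV : w \notin V by apply: contra gw => /(subvP Vg); rewrite memv_ker.
have V'S : (V + <[w]> <= US S)%VS by rewrite subv_add VS -memvE.
exists (V + <[w]>)%VS; split.
- exact: subv_trans V'S (capvSl _ _).
- by apply: contraNneq V0 => e; rewrite -subv0 -e addvSl.
- rewrite ltnNge; apply: contra wV => le.
  have /eqP -> : V == (V + <[w]>)%VS by rewrite eqEdim addvSl.
  by rewrite memvE addvSr.
apply/subset_leq_card/subsetP => i; rewrite inE; apply: contraR => iS.
apply: subv_trans V'S (subv_trans (capvSr _ _) _).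
apply: (@bigcapv_inf _ _ _ i); last exact: subvv.
by rewrite inE.
Qed.

End Supports.

(** * The simultaneous induction for (A) and (B) *)

Section Main.
Variables (F : fieldType) (m : nat) (vT : vectType F).
Hypothesis hchar : 3 \in [pchar F].
Hypothesis hinf : forall s : seq F, exists x, x \notin s.
Local Notation A := (sqfree F m).
Local Notation columns := ('I_m -> 'Hom(vT, F^o)).
Implicit Types (f g h : A) (c : columns) (u v y : vT) (U V : {vspace vT})
  (X Y : seq vT) (i j : 'I_m) (gam : 'Hom(vT, F^o)).

(* Parts (A) and (B) for the forms [lin c v], v in <<X>>, with strict degree bounds
   instead of homogeneity: with n = size X, the paper's k is [k - 1] in (A), and
   [d - 2n + 1] in (B). *)
Definition suppA c X k := forall V, (V <= <<X>>)%VS -> V != 0%VS ->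
  (4 * \dim V + 2 * k <= #|col_supp c V| + 4)%N.

Definition suppB c X d := forall V, (V <= <<X>>)%VS -> V != 0%VS ->
  (2 * d + 4 * \dim V <= #|col_supp c V| + 4 * size X + 1)%N.

Definition propA c X k := free X -> suppA c X k ->
  forall f, degb k f -> f * sqprod c X = 0 -> lin_ideal c <<X>> k.-1 f.

Definition propB c X d := free X -> suppB c X d ->
  forall f, degb d f -> (forall v, v \in <<X>>%VS -> f * lin c v = 0) ->
  exists g, degb (d - 2 * size X) g /\ f = sqprod c X * g.

Lemma free_span_neq0 X : free X -> (0 < size X)%N -> <<X>>%VS != 0%VS.
Proof. by move=> fX X0; rewrite -dimv_eq0 (eqP fX) -lt0n. Qed.

Lemma lin_set_col0 c j v : c j v = 0 -> lin (set_col c j 0) v = lin c v.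
Proof. by move=> e; apply: lin_set_col_id; rewrite e lfunE. Qed.

Lemma sigma_lin_id c j v : c j v = 0 -> sigma j (lin c v) = lin c v.
Proof. by move=> e; rewrite sigma_lin lin_set_col0. Qed.

Lemma lin_split c j v : lin c v = lin (set_col c j 0) v + (c j v : F) *: var F j.
Proof. by rewrite [LHS](sigma_del j) sigma_lin del_lin -scalerAr mulr1. Qed.

Lemma sigma_sqprod_id c j X : {in X, forall v, c j v = 0} ->
  sigma j (sqprod c X) = sqprod c X.
Proof. by move=> e; rewrite sigma_sqprod sqprod_set_col // => v /e->; rewrite lfunE. Qed.

Lemma mul3r f : 3%:R * f = 0.
Proof. by rewrite natr3 // mul0r. Qed.

Lemma span0 X gam : {in X, forall v, gam v = 0} -> forall v, v \in <<X>>%VS -> gam v = 0.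
Proof.
move=> e v vX; apply/eqP; rewrite -memv_ker; apply: (subvP _ v vX).
by apply/span_subvP => w /e; rewrite memv_ker => ->.
Qed.

Lemma exists_col_supp c V : (0 < #|col_supp c V|)%N -> exists j, ~~ (V <= lker (c j))%VS.
Proof. by case/card_gt0P => j; rewrite inE; exists j. Qed.

(** Modulo [lin c u = l0 + x], [f] becomes some [g] without [x]. (B) for the projected forms makes
    [W * g] a multiple of [l0 ^+ 2 * W], and (A) for the hyperplane [<<Y>>] finishes because
    [l0 ^+ 2] is itself a multiple of [lin c u]. *)
Lemma propA_step c X k :
  (0 < size X)%N ->
  (forall c Y, size X = (size Y).+1 -> propA c Y k) ->
  ((0 < k)%N -> forall c Y, size Y = size X -> propB c Y (k + 2 * (size X).-1)) ->
  propA c X k.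
Proof.
move=> X0 IHA IHB fX sA f df fP.
have [k0|k0] := posnP k.
  by move: df; rewrite k0 => /degb_eq0->; constructor.
have [|j cj] := @exists_col_supp c <<X>>%VS.
  have := sA _ (subvv _) (free_span_neq0 fX X0); rewrite (eqP fX); lia.
have [u [Y [a [fuY spX sX cu [cY [a0 PX]]]]]] := adapted_basis m hchar fX cj.
have {a a0 PX} {}fP : f * sqprod c (u :: Y) = 0.
  by apply/(scalerI a0); rewrite scaler0 scalerAr -PX.
have fY : free Y by move: fuY; rewrite free_cons => /andP[].
set c0 := set_col c j 0; pose l0 := lin c0 u; pose W := sqprod c Y; pose x := var F j.
have lE : lin c u = l0 + x by rewrite (lin_split c j) cu scale1r.
have sW : sigma j W = W by apply: sigma_sqprod_id.
have dW : del j W = 0 by rewrite -sW del_sigma.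
have W0 : sqprod c0 Y = W by rewrite -sigma_sqprod.
have x2 : x ^+ 2 = 0 by apply: var_sq.
pose f0 := sigma j f; pose f1 := del j f; have fE : f = f0 + x * f1 by apply: sigma_del.
(* The result of replacing [x] by [- l0] in [f0 + x * f1], so that [f = g + lin c u * f1]. *)
pose g : A := f0 - l0 * f1.
have dl0 : degb 2 l0 by apply: degb_lin.
have df1 : degb k.-1 f1 by apply: degb_del.
have dg : degb k g.
  by apply: degbB; [apply: degb_sigma|apply: degb_mul1].
(* The coefficient of [x] in [fP] is [W * (2 * l0 * f0 + l0 ^+ 2 * f1)], which is [- W * l0 * g] as
   2 = -1; [mul3r] supplies the multiple of 3 for [ring]. *)
have Wg : W * l0 * g = 0.
  have := congr1 (del j) fP; rewrite linear0 sqprod_cons -/W expr2 !(delM, sigmaM).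
  rewrite sW dW sigma_lin del_lin cu scale1r -/c0 -/l0 -/f0 -/f1 => e.
  by rewrite -oppr0 -e -[LHS]addr0 -{1}(mul3r (- W * l0 * f0)) /g; ring.
(* Setting column [j] to 0 costs at most one variable, exactly the difference between the bounds
   [suppA] and [suppB] here. *)
have [||||h [dh Wgh]] := IHB k0 c0 (u :: Y) _ fuY _ (W * g).
- by rewrite sX.
- move=> V; rewrite spX => VX V0; have := sA V VX V0; have := col_supp_set_col c j 0 V.
  rewrite -/c0 sX /=; lia.
- by rewrite sX /= mulrC; apply: degbM => //; exact: degb_sqprod.
- move=> v; rewrite span_cons => /memv_addP[_ /vlineP[b ->] [y yY ->]].
  rewrite linearD linearZ /= -/l0 mulrDr -scalerAr mulrAC Wg scaler0 add0r.
  by rewrite mulrAC -W0 sqprod_lin0 // mul0r.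
rewrite sX /= in dh; rewrite sqprod_cons W0 -/l0 in Wgh.
have r_ideal : lin_ideal c0 <<Y>> k.-1 (g - l0 ^+ 2 * h).
  apply: IHA => //.
  - move=> V VY V0; apply: leq_trans (sA V _ V0) _.
      by rewrite -spX (subv_trans VY) // span_cons addvSr.
    rewrite leq_add2r; apply: col_supp_set_col_ge => _; apply: subv_trans VY _.
    by apply/span_subvP => y /cY; rewrite memv_ker => ->.
  - apply: degbB => //; rewrite expr2 -mulrA; do 2!apply: degb_mul1 => //.
    by apply: degbW dh; lia.
  - by rewrite W0 mulrBl [g * W]mulrC Wgh; ring.
(* Here [lin c u * (l0 - x) = l0 ^+ 2], because [x ^+ 2 = 0]. *)
have -> : f = lin c u * (f1 + (l0 - x) * h) + (g - l0 ^+ 2 * h).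
  by rewrite lE fE -[LHS]addr0 -[0](mulr0 (- h)) -x2 /g; ring.
constructor.
- by rewrite -spX memv_span ?mem_head.
- apply: degbD => //; apply: degb_mul1; last by apply: degbW dh; lia.
  by apply: degbB => //; apply: degb_var.
rewrite -spX; apply: lin_idealW (_ : lin_ideal c <<Y>> _ _); first by rewrite span_cons addvSr.
apply: lin_ideal_col r_ideal => v vY; apply: lin_set_col0.
exact: (span0 cY).
Qed.

(** Being killed by [l0 + x] forces [f = (x - l0) * f1]. (B) for the hyperplane [<<Y>>] gives
    [f1 = W * h], and (A) for the projected forms gives [h = l0 * h1] up to terms killed by [W]. The
    hypothesis on [V] inside [lker (c j)] is the support bound for that use of (B). *)
Lemma propB_step c X k j :
  (0 < size X)%N -> (0 < k)%N ->
  (forall c Y d, size X = (size Y).+1 -> propB c Y d) ->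
  (forall c Y, size Y = size X -> propA c Y k.-1) ->
  ~~ (<<X>> <= lker (c j))%VS ->
  (forall V, (V <= <<X>>)%VS -> V != 0%VS -> (V <= lker (c j))%VS ->
    (4 * \dim V + 2 * k <= #|col_supp c V| + 3)%N) ->
  propB c X (k + 2 * (size X).-1).
Proof.
move=> X0 k0 IHB IHA cj sV fX sB f df fX0.
have [u [Y [a [fuY spX sX cu [cY [a0 PX]]]]]] := adapted_basis m hchar fX cj.
have fY : free Y by move: fuY; rewrite free_cons => /andP[].
have sYX : (<<Y>> <= <<X>>)%VS by rewrite -spX span_cons addvSr.
have uX : u \in <<X>>%VS by rewrite -spX memv_span ?mem_head.
set c0 := set_col c j 0; pose l0 := lin c0 u; pose W := sqprod c Y; pose x := var F j.
have lE : lin c u = l0 + x by rewrite (lin_split c j) cu scale1r.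
have W0 : sqprod c0 Y = W by rewrite -sigma_sqprod; apply: sigma_sqprod_id.
have x2 : x ^+ 2 = 0 by apply: var_sq.
pose f0 := sigma j f; pose f1 := del j f; have fE : f = f0 + x * f1 by apply: sigma_del.
have f0E : f0 = - (f1 * l0).
  have := congr1 (del j) (fX0 u uX).
  rewrite linear0 delM del_lin cu scale1r sigma_lin mulr1 => /eqP.
  by rewrite addr_eq0 => /eqP.
have f1l0 : f1 * l0 ^+ 2 = 0.
  have := congr1 (sigma j) (fX0 u uX); rewrite linear0 sigmaM sigma_lin -/f0 f0E -/c0 -/l0.
  by rewrite mulNr -mulrA -expr2 => /eqP; rewrite oppr_eq0 => /eqP.
have lY v : v \in <<Y>>%VS -> lin c0 v = lin c v.
  by move=> vY; apply: lin_set_col0; apply: (span0 cY).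
have f1Y v : v \in <<Y>>%VS -> f1 * lin c0 v = 0.
  move=> vY; have := congr1 (del j) (fX0 v (subvP sYX v vY)).
  by rewrite linear0 delM del_lin (span0 cY vY) scale0r mulr0 add0r sigma_lin.
have [|||h [dh f1E]] := IHB c0 Y (k + 2 * (size X).-1).-1 sX fY _ f1.
- move=> V VY V0; have VX := subv_trans VY sYX.
  have Vj : (V <= lker (c j))%VS.
    by apply: subv_trans VY _; apply/span_subvP => y /cY; rewrite memv_ker => ->.
  have := sV V VX V0 Vj; have := @col_supp_set_col_ge _ _ _ c j 0 V (fun=> Vj).
  rewrite -/c0 sX /=; move: k0; move: (\dim V) #|_| #|_| (size Y); clear; lia.
- exact: degb_del.
- exact: f1Y.
rewrite W0 in f1E; rewrite sX /= in dh.
have h_ideal : lin_ideal c0 <<u :: Y>> k.-1.-1 h.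
  apply: IHA => //.
  - move=> V; rewrite spX => VX V0; have := sB V VX V0.
    have := col_supp_set_col c j 0 V; rewrite -/c0 sX /=.
    by move: k0; move: (\dim V) #|_| #|_| (size Y); clear; lia.
  - by apply: degbW dh; clear; lia.
  by rewrite sqprod_cons W0 -/l0 mulrA [h * _]mulrC -mulrA [h * W]mulrC -f1E mulrC.
have [h1 [r [dh1 rY hE]]] := lin_ideal_cons h_ideal.
have Wr : W * r = 0.
  apply: lin_ideal_kill rY => v vY; rewrite -W0; exact: sqprod_lin0.
(* The sign comes from [(x - l0) * l0 = - lin c u ^+ 2], true since 2 = -1; the scalar passes from
   the basis [u :: Y] back to [X]. *)
exists (- (a^-1 *: h1)); split.
  by apply/degbN/degbZ; apply: degbW dh1; clear; lia.
rewrite PX mulrN -scalerAl -scalerAr scalerA mulfV // scale1r sqprod_cons -/W lE.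
rewrite fE f0E f1E hE -/l0.
have -> : W * (l0 * h1 + r) = W * l0 * h1 by rewrite mulrDr Wr addr0 mulrA.
rewrite -[LHS]addr0 -[0](mul3r (- (x * l0 * W * h1))) -[LHS]addr0 -[0](mulr0 (- (W * h1))) -x2.
ring.
Qed.

(** (B) on the hyperplane [<<Y>>] cut out by a generic [gam] writes [f] as [sqprod c Y * g]. If the
    chosen column [c j] is proportional to [gam] on [<<X>>], [propB_step] applies to [c]; otherwise
    it is applied after putting [gam] in column [j], to extract the missing square from [g]. *)
Lemma propB_generic c X d :
  (0 < size X)%N ->
  (forall c Y k, size X = (size Y).+1 -> propA c Y k) ->
  (forall c Y d, size X = (size Y).+1 -> propB c Y d) ->
  ((0 < d - 2 * (size X).-1)%N ->
    forall c Y, size Y = size X -> propA c Y (d - 2 * (size X).-1).-1) ->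
  propB c X d.
Proof.
move=> X0 IHA IHB IHk fX sB f df fX0.
have [gam hgam] := generic_functional c <<X>>%VS hinf.
have gX : ~~ (<<X>> <= lker gam)%VS.
  apply/negP => gX; have [V' [V'X _ lt _]] := hgam _ (subvv _) (free_span_neq0 fX X0) gX.
  by have := dimvS V'X; rewrite leqNgt lt.
(* The gain of 4: the bound [sB] is applied to a larger [V'] whose support is no bigger than that of
   [V]. *)
have sV V : (V <= <<X>>)%VS -> V != 0%VS -> (V <= lker gam)%VS ->
    (2 * d + 4 * (\dim V).+1 <= #|col_supp c V| + 4 * size X + 1)%N.
  move=> VX V0 Vg; have [V' [V'X V'0 lt le]] := hgam V VX V0 Vg.
  have := sB V' V'X V'0; move: lt le.
  by move: (\dim V) (\dim V') #|_| #|_| (size X); clear; lia.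
have [u [Y [a [fuY spX sX gu [gY [a0 PX]]]]]] := adapted_basis m hchar fX gX.
have fY : free Y by move: fuY; rewrite free_cons => /andP[].
have sYX : (<<Y>> <= <<X>>)%VS by rewrite -spX span_cons addvSr.
have uX : u \in <<X>>%VS by rewrite -spX memv_span ?mem_head.
have sYg : (<<Y>> <= lker gam)%VS.
  by apply/span_subvP => y /gY; rewrite memv_ker => ->.
have [||g [dg fE]] := IHB c Y d sX fY _ f df.
- move=> V VY V0; have := sV V (subv_trans VY sYX) V0 (subv_trans VY sYg).
  by rewrite sX; move: (\dim V) #|_| (size Y); clear; lia.
- by move=> v vY; apply: fX0; apply: (subvP sYX).
rewrite sX /= in IHk dg.
have [k0|k0] := posnP (d - 2 * size Y).
  by exists 0; split; [exact: degb0|rewrite fE (degb_eq0 (f := g)) ?mulr0 // -k0].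
set k := (d - 2 * size Y)%N in k0 IHk dg.
have dE : d = (k + 2 * (size X).-1)%N by rewrite sX /k; move: k0; rewrite /k; move: (size Y); clear; lia.
clearbody k.
have {}IHk c' X' : size X' = size X -> propA c' X' k.-1 by rewrite sX; apply: IHk.
have [|j cj] := @exists_col_supp c <<X>>%VS.
  have := sB _ (subvv _) (free_span_neq0 fX X0); rewrite (eqP fX) dE sX /=.
  by move: k0; move: #|_| (size Y); clear; lia.
have [cjY|cjY] := boolP (<<Y>> <= lker (c j))%VS.
  have cju : c j u != 0.
    apply: contra cj => cju; rewrite -spX span_cons subv_add cjY andbT.
    by rewrite -memvE memv_ker.
  have pB : propB c X d; last exact: pB.
  rewrite dE; apply: (@propB_step c X k j) => // V VX V0 Vj.
  (* Inside [<<X>>], both [c j] and [gam] have kernel [<<Y>>]. *)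
  have Vg : (V <= lker gam)%VS.
    apply/subvP => v vV; have := subvP VX v vV; have := subvP Vj v vV.
    rewrite -spX span_cons memv_ker => cv /memv_addP[_ /vlineP[b ->] [y yY vE]].
    move: cv; rewrite vE linearD linearZ /=.
    have /eqP -> : c j y == 0 by rewrite -memv_ker (subvP cjY).
    rewrite addr0 scaler_eq0 (negPf cju) orbF => /eqP->.
    by rewrite scale0r add0r (subvP sYg).
  have := sV V VX V0 Vg; rewrite dE sX /=.
  by move: (\dim V) #|_| (size Y); clear; lia.
have [u1 [Z [b [fuZ spY sY cu1 [cZ [b0 PY]]]]]] := adapted_basis m hchar fY cjY.
have u1Y : u1 \in <<Y>>%VS by rewrite -spY memv_span ?mem_head.
have sZY : (<<Z>> <= <<Y>>)%VS by rewrite -spY span_cons addvSr.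
(* On [u2], [u1] and [Z], the functional [gam] takes the values 1, 0, 0 and [c j] the values 0, 1,
   0. *)
pose u2 := u - (c j u : F) *: u1.
have gY' v : v \in <<Y>>%VS -> gam v = 0 by apply: span0.
have cZ' v : v \in <<Z>>%VS -> c j v = 0 by apply: span0.
have gu2 : gam u2 = 1 by rewrite linearB linearZ /= (gY' _ u1Y) scaler0 subr0.
have cu2 : c j u2 = 0.
  by rewrite linearB linearZ /= cu1; apply/eqP; rewrite subr_eq0 -[X in X == _]mulr1.
have spX2 : <<u2 :: u1 :: Z>>%VS = <<X>>%VS.
  rewrite span_cons spY -spX [in RHS]span_cons; apply/eqP; rewrite eqEsubv !subv_add !addvSr !andbT.
  have memY w : u1 \in (<[w]> + <<Y>>)%VS by apply: subvP (addvSr _ _) _ u1Y.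
  have memL w : w \in (<[w]> + <<Y>>)%VS by apply: subvP (addvSl _ _) _ (memv_line w).
  rewrite -!memvE memvB ?memvZ //= -[X in X \in _](subrK ((c j u : F) *: u1)).
  by rewrite memvD ?memvZ.
have fX2 : free (u2 :: u1 :: Z) by rewrite /free spX2 (eqP fX) sX sY.
have fuZ2 : free (u2 :: Z).
  have : free (u1 :: u2 :: Z).
    by rewrite (perm_free (Y := u2 :: u1 :: Z)) // (perm_catCA [:: u1] [:: u2] Z).
  by rewrite free_cons => /andP[].
have suZ2 : (<<u2 :: Z>> <= <<X>>)%VS.
  by rewrite -spX2 !span_cons addvS ?addvSr.
have PX2 : sqprod c X = (a * b) *: sqprod c (u2 :: u1 :: Z).
  rewrite PX sqprod_cons PY -scalerAr scalerA; congr (_ *: _).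
  have := sqprod_shear hchar c u1 (fun=> c j u : F) [:: u].
  rewrite !sqprod_cons !big_cons !big_nil !mulr1 -/u2.
  move: (lin c u1 ^+ 2) (lin c u ^+ 2) (lin c u2 ^+ 2) (sqprod c Z) => p q r W e.
  by rewrite mulrCA mulrA -e -mulrA mulrCA.
(* Now [x_j] gets the generic functional [gam] as column: [propB_step] applies to
   [c'], and its conclusion for [gh * t ^+ 2 * W] is what is needed to divide [g]. *)
pose c' := set_col c j gam.
have sX2 : size (u2 :: u1 :: Z) = size X by rewrite sX sY.
have pB : propB c' (u2 :: u1 :: Z) d.
  have := @propB_step c' (u2 :: u1 :: Z) k j.
  rewrite sX2 -dE spX2; apply=> //.
  - by rewrite /c' /set_col eqxx.
  move=> V VX V0; rewrite {1}/c' /set_col eqxx => Vg.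
  have := sV V VX V0 Vg; have := col_supp_set_col c j gam V.
  rewrite dE sX /= -/c'.
  by move: (\dim V) #|_| #|_| (size Y); clear; lia.
(* For [V] in the kernel of [gam], the gain in [sV] covers the possible loss of [j]; for any other
   [V], the new support contains [j]. *)
have sB' : suppB c' (u2 :: u1 :: Z) d.
  move=> V; rewrite spX2 sX2 => VX V0.
  have [Vg|Vg] := boolP (V <= lker gam)%VS.
    have := sV V VX V0 Vg; have := col_supp_set_col c j gam V; rewrite -/c'.
    by move: (\dim V) #|_| #|_| (size X); clear; lia.
  apply: leq_trans (sB V VX V0) _; rewrite !leq_add2r.
  by apply: col_supp_set_col_ge; rewrite (negPf Vg).
have pA : propA c' (u2 :: Z) k by apply: IHA; rewrite sX sY.
(* The old column [j] vanishes on [<<u2 :: Z>>], so no variable is lost. Where [gam] is nonzero, [j]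
   is gained, which makes up for the distance from [suppB] to [suppA]. *)
have sA' : suppA c' (u2 :: Z) k.
  move=> V VZ V0; have VX := subv_trans VZ suZ2.
  have Vj : (V <= lker (c j))%VS.
    apply: subv_trans VZ _; apply/span_subvP => v; rewrite inE memv_ker.
    by case/orP=> [/eqP->|/cZ->]; rewrite ?cu2.
  have [Vg|Vg] := boolP (V <= lker gam)%VS.
    have := sV V VX V0 Vg; have := @col_supp_set_col_ge _ _ _ c j gam V (fun=> Vj).
    rewrite -/c' dE sX /=.
    by move: (\dim V) #|_| #|_| (size Y); clear; lia.
  have := sB V VX V0; have := col_supp_set_col_gt Vg Vj.
  rewrite -/c' dE sX /=.
  by move: (\dim V) #|_| #|_| (size Y); clear; lia.
set c0 := set_col c j 0; pose x := var F j.
pose s := lin c u2; pose l0 := lin c0 u1; pose l := lin c u1; pose W := sqprod c Z.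
have lE : l = l0 + x by rewrite /l (lin_split c j) cu1 scale1r.
have x2 : x ^+ 2 = 0 by apply: var_sq.
have l3 : l ^+ 3 = 0 by apply: lin_cube.
have c'u2 : lin c' u2 = s + x.
  by rewrite /c' lin_set_col gu2 scale1r lin_set_col0.
have c'Y v : v \in <<Y>>%VS -> lin c' v = lin c0 v.
  by move=> vY; rewrite /c' lin_set_col gY' // scale0r addr0.
have c'W : sqprod c' Z = W.
  by apply: sqprod_set_col => v vZ; rewrite gY' ?cZ // (subvP sZY) // memv_span.
have sW : sigma j W = W by apply: sigma_sqprod_id.
have dW : del j W = 0 by rewrite -sW del_sigma.
pose g0 := sigma j g; pose g1 := del j g; have gE : g = g0 + x * g1 by apply: sigma_del.
pose gh : A := g0 - l0 * g1.
have {}fE : f = b *: (l ^+ 2 * W * g) by rewrite fE PY sqprod_cons -scalerAl.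
(* The coefficient of [x] in [l ^+ 2 * W * g * s = 0], again with 2 = -1; [gh] is [g] reduced modulo
   [l]. *)
have E1 : W * s * l0 * gh = 0.
  have u2X : u2 \in <<X>>%VS by rewrite -spX2 memv_span ?mem_head.
  have : l ^+ 2 * W * g * s = 0.
    by apply/(scalerI b0); rewrite scaler0 scalerAl -fE fX0.
  move/(congr1 (del j)); rewrite linear0 expr2 !(delM, sigmaM) sW dW.
  rewrite !sigma_lin !del_lin cu1 cu2 scale1r scale0r -/c0 -/l0 -/g0 -/g1.
  rewrite (lin_set_col0 cu2) -/s => e.
  by rewrite -oppr0 -e -[LHS]addr0 -{1}(mul3r (- W * s * l0 * g0)) /gh; ring.
have degl0 : degb 2 l0 by apply: degb_lin.
have dgh : degb k gh.
  by apply: degbB; [apply: degb_sigma|apply: degb_mul1; last exact: degb_del].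
pose t := s + x.
(* The element [gh * (t ^+ 2 * W)] is killed by every [lin c' v]: [t] and the forms of [Z] produce
   cubes, and [l0] is handled by [E1] and [x ^+ 2 = 0]. *)
have [||h [dh zE]] := pB fX2 sB' (gh * (t ^+ 2 * W)).
- have -> : d = (k + 2 * size (u2 :: Z))%N by rewrite dE sX sY.
  by rewrite -c'W /t -c'u2 -sqprod_cons; apply: degbM => //; apply: degb_sqprod.
- move=> v; rewrite span_cons spY => /memv_addP[_ /vlineP[r ->] [y yY ->]].
  have tZ : t ^+ 2 * W * t = 0.
    rewrite /t -c'u2 -c'W -sqprod_cons; apply: (sqprod_lin0 hchar).
    by rewrite memv_span ?mem_head.
  rewrite linearD linearZ /= c'u2 -/t mulrDr -scalerAr -[in X in _ *: X]mulrA tZ mulr0 scaler0 add0r.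
  move: yY; rewrite -spY span_cons => /memv_addP[_ /vlineP[q ->] [w wZ ->]].
  rewrite linearD linearZ /= c'Y // -/l0 mulrDr -scalerAr.
  have -> : gh * (t ^+ 2 * W) * l0 = W * s * l0 * gh * (s + 2%:R * x) + W * l0 * gh * x ^+ 2.
    by rewrite /t; ring.
  rewrite E1 x2 mul0r mulr0 addr0 scaler0 add0r.
  by rewrite -!mulrA -c'W (sqprod_lin0 hchar) ?mulr0.
rewrite !sqprod_cons c'u2 c'Y // c'W -/l0 -/t in zE.
rewrite sX2 in dh.
have q_ideal : lin_ideal c' <<u2 :: Z>> k.-1 (gh - l0 ^+ 2 * h).
  apply: pA => //.
    apply: degbB => //; rewrite expr2 -mulrA; do 2!apply: degb_mul1 => //.
    by apply: degbW dh; rewrite dE sX; clear; lia.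
  rewrite sqprod_cons c'u2 c'W -/t mulrBl zE; ring.
have [q [r [dq rZ qE]]] := lin_ideal_cons q_ideal.
rewrite c'u2 -/t in qE.
have Wr : W * r = 0.
  by apply: lin_ideal_kill rZ => v vZ; rewrite -c'W; exact: (sqprod_lin0 hchar).
pose q0 := sigma j q; pose q1 := del j q; pose h0 := sigma j h; pose h1 := del j h.
have Wq : W * gh = W * l0 ^+ 2 * h + W * (t * q).
  by rewrite -[gh](subrK (l0 ^+ 2 * h)) qE !mulrDr Wr addr0 addrC [W * (l0 ^+ 2 * h)]mulrA.
have sl0 : sigma j l0 = l0 by rewrite /l0 -sigma_lin sigma_sigma.
have dl0 : del j l0 = 0 by rewrite /l0 -sigma_lin del_sigma.
have ss : sigma j s = s by apply: sigma_lin_id.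
have ds : del j s = 0 by rewrite -ss del_sigma.
have sgh : sigma j gh = gh.
  by rewrite linearB /= sigmaM sl0 sigma_sigma sigma_del_id.
have dgh0 : del j gh = 0 by rewrite -sgh del_sigma.
have st : sigma j t = s by rewrite linearD /= ss sigma_var eqxx addr0.
have dt : del j t = 1 by rewrite linearD /= ds del_var eqxx add0r.
(* Since [W], [gh], [l0] and [s] do not involve [x], [Wq] splits into its two coefficients; the
   second expresses [W * q0] through [q1], whose degree is one lower than that of [q]. *)
have Wq0 : W * gh = W * l0 ^+ 2 * h0 + W * (s * q0).
  have := congr1 (sigma j) Wq.
  by rewrite linearD /= expr2 !sigmaM sW sgh sl0 st.
have Wq1 : W * q0 = - (W * l0 ^+ 2 * h1 + W * s * q1).
  have := congr1 (del j) Wq.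
  rewrite linearD /= expr2 !(delM, sigmaM) sW dW sgh dgh0 sl0 dl0 st dt -/q0 -/q1 -/h0 -/h1.
  by move=> /eqP; rewrite -subr_eq0 => /eqP e; rewrite -[LHS]addr0 -e; ring.
have l2l0 : l ^+ 2 * l0 ^+ 2 = 0.
  have -> : l0 = l - x by rewrite lE addrK.
  have -> : l ^+ 2 * (l - x) ^+ 2 = l ^+ 3 * (l - 2%:R * x) + l ^+ 2 * x ^+ 2 by ring.
  by rewrite l3 x2 mul0r mulr0 addr0.
(* The factor [l ^+ 2] allows [g] to be replaced by [gh] and kills each term with [l0 ^+ 2]; what
   survives carries the missing square [s ^+ 2]. *)
have E2 : l ^+ 2 * W * g = - (l ^+ 2 * s ^+ 2 * W * q1).
  have -> : g = gh + l * g1 by rewrite gE lE /gh; ring.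
  have -> : l ^+ 2 * W * (gh + l * g1) = l ^+ 2 * (W * gh) + l ^+ 3 * (W * g1) by ring.
  rewrite l3 mul0r addr0 Wq0.
  have -> : l ^+ 2 * (W * l0 ^+ 2 * h0 + W * (s * q0)) =
     l ^+ 2 * l0 ^+ 2 * (W * h0) + l ^+ 2 * s * (W * q0) by ring.
  rewrite Wq1.
  have -> : l ^+ 2 * s * - (W * l0 ^+ 2 * h1 + W * s * q1) =
     - (l ^+ 2 * s ^+ 2 * W * q1) - l ^+ 2 * l0 ^+ 2 * (W * s * h1) by ring.
  by rewrite l2l0 !mul0r subr0 add0r.
exists (- (a^-1 *: q1)); split.
  have dq1 : degb k.-1.-1 q1 by apply: degb_del.
  by apply/degbN/degbZ; apply: degbW dq1; rewrite dE sX /=; clear; lia.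
rewrite fE E2 PX2 !sqprod_cons -/l -/s -/W !mulrN -scalerAl -scalerAr scalerA scalerN.
have -> : a * b / a = b by rewrite mulrAC divff // mul1r.
by congr (- (_ *: _)); ring.
Qed.

(** Induction on the number of forms and, inside, on the degree in (A). With n+1 forms, (A) at [k]
    uses (B) at [k + 2 * n], which in turn uses (A) at [k.-1]; once (A) holds at every degree, so
    does (B). *)
Lemma propAB n c X k : size X = n -> propA c X k /\ propB c X k.
Proof.
elim: n c X k => [|n IH] c X k sX.
  move: sX => /size0nil->; split=> _ _ f df; rewrite /sqprod big_nil.
    by rewrite mulr1 => ->; constructor.
  by exists f; rewrite mul1r subn0.
have IHA c' Y k' : size Y = n -> propA c' Y k' by case/(IH c' Y k').
have IHB c' Y d : size Y = n -> propB c' Y d by case/(IH c' Y d).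
have A_imp_B k' c' Y : size Y = n.+1 ->
    ((0 < k' - 2 * n)%N -> forall c'' Z, size Z = n.+1 -> propA c'' Z (k' - 2 * n).-1) ->
    propB c' Y k'.
  by move=> sY IHk; apply: propB_generic; rewrite ?sY // => c'' Z d [/esym]; auto.
have allA k' c' Y : size Y = n.+1 -> propA c' Y k'.
  elim: k' c' Y => [|k' IHk] c' Y sY; apply: propA_step; rewrite ?sY //.
  - by move=> c'' Z [/esym]; apply: IHA.
  - by move=> c'' Z [/esym]; apply: IHA.
  by move=> _ c'' Z sZ; apply: A_imp_B; rewrite ?addnK.
by split; [apply: allA|apply: A_imp_B => // _ c' Z; apply: allA].
Qed.

End Main.

(** * Vanishing of products of more than 2n forms from an n-dimensional space *)

Section Powers.
Variables (F : fieldType) (m : nat) (vT : vectType F).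
Hypothesis hchar : 3 \in [pchar F].
Local Notation A := (sqfree F m).
Implicit Types (z : A) (c : 'I_m -> 'Hom(vT, F^o)) (X s t : seq vT).

(** By the pigeonhole principle some element of [X] occurs three times in [t]. *)
Lemma prod_basis_eq0 c X t : {subset t <= X} -> (2 * size X < size t)%N ->
  \prod_(v <- t) lin c v = 0 :> A.
Proof.
elim: X t => [|x X IH] t tX st.
  by case: t tX st => // v t /(_ v (mem_head _ _)).
rewrite (bigID (pred1 x)) /= -big_filter -[X in _ * X]big_filter.
have [le2|lt3] := leqP (count_mem x t) 2.
  rewrite [X in _ * X]IH ?mulr0 //.
    by move=> v; rewrite mem_filter => /andP[vx /tX]; rewrite inE (negPf vx).
  have := count_predC (pred1 x) t; rewrite -[X in (_ < X)%N]/(size (filter (predC1 x) t)).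
  rewrite size_filter; move: st => /=; move: le2.
  by move: (count _ t) (count _ t) (size t) (size X); clear; lia.
rewrite (eq_big_seq (fun=> lin c x)) => [|v]; last by rewrite mem_filter => /andP[/eqP->].
rewrite big_const_seq count_predT size_filter -/(GRing.exp _ _) iter_mulr_1.
by rewrite -(subnKC lt3) exprD lin_cube // !mul0r.
Qed.

Lemma prod_span_eq0 c X s : {subset s <= <<X>>%VS} -> (2 * size X < size s)%N ->
  \prod_(v <- s) lin c v = 0 :> A.
Proof.
(* Multilinear expansion one factor at a time: [z] collects the factors of [s] already passed, while
   the rest is replaced by arbitrary elements of [X]. *)
move=> sX ss; suff gen z : (forall t, size t = size s -> {subset t <= X} ->
    z * \prod_(v <- t) lin c v = 0) -> z * \prod_(v <- s) lin c v = 0.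
  rewrite -[LHS]mul1r; apply: gen => t st tX.
  by rewrite mul1r (prod_basis_eq0 c tX) // st.
elim: s z sX {ss} => [|u s IH] z sX zX.
  by apply: zX.
rewrite big_cons mulrA; apply: IH => [v vs|t st tX]; first by rewrite sX // inE vs orbT.
rewrite (coord_span (X := in_tuple X) (sX u (mem_head _ _))) linear_sum mulr_sumr mulr_suml.
rewrite big1 // => i _; rewrite linearZ /= -scalerAr -scalerAl -mulrA.
have := zX ((in_tuple X)`_i :: t); rewrite big_cons => ->; rewrite ?scaler0 //= ?st // => v; rewrite inE => /orP[/eqP->|/tX //].
by rewrite mem_nth.
Qed.

End Powers.

(** * From parametrized forms back to subspaces of the algebra *)

Section Translation.
Variables (F : fieldType) (m : nat).
Local Notation A := (sqfree F m).
Implicit Types (f : alg F m) (U V : {vspace alg F m}).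

Definition coef1 (i : 'I_m) f : F^o := f [set i].

Fact coef1_linear i : linear (coef1 i).
Proof. by move=> a f g; rewrite /coef1 !ffunE. Qed.
HB.instance Definition _ i :=
  GRing.isLinear.Build F (alg F m) F^o *:%R (coef1 i) (coef1_linear i).

Definition coord_columns (i : 'I_m) : 'Hom(alg F m, F^o) := linfun (coef1 i).

Lemma lin_coord_columns f : homog 1 f -> lin coord_columns f = f.
Proof.
move=> f1; apply/ffunP=> T; rewrite /lin sum_ffunE.
have [f0|fT] := eqVneq (f T) 0.
  rewrite f0 big1 // => i _; rewrite !ffunE lfunE.
  by case: eqP => [e|_]; rewrite ?scaler0 //= /coef1 -e f0 scale0r.
have /eqP/cards1P[j ->] := f1 _ fT.
rewrite (bigD1 j) //= !ffunE lfunE eqxx big1 ?addr0 => [|i ij]; first exact: mulr1.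
by rewrite !ffunE (inj_eq set1_inj) eq_sym (negPf ij) scaler0.
Qed.

Lemma col_supp_coord_columns V : col_supp coord_columns V = supp V.
Proof.
apply/setP => i; rewrite !inE; apply/subvPn/asboolP => [[v vV]|[v [vV vi]]].
  by rewrite memv_ker lfunE; exists v.
by exists v => //; rewrite memv_ker lfunE.
Qed.

(** [V] itself satisfies the predicate searched by [find] at position [#|supp V|], so the search
    cannot stop later. *)
Lemma ms_le_supp U V : (V <= U)%VS -> (ms U (\dim V) <= #|supp V|)%N.
Proof.
move=> VU; rewrite leqNgt; apply/negP => lt.
have := before_find 0%N lt; rewrite nth_iota ?add0n; last first.
  by rewrite ltnS -[X in (_ <= X)%N]card_ord max_card.
by move/asboolP; apply; exists V.
Qed.

Lemma foldr_amul (s : seq (alg F m)) : foldr (@amul F m) (aone F m) s = \prod_(u <- s) (u : A).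
Proof. by elim: s => [|u s IH]; rewrite ?big_nil // big_cons /= IH. Qed.

End Translation.

(** * The two annihilators, through the facts that U^(2n) contains [sqprod] of a basis and is killed
    by U *)

Section Ideals.
Variables (F : fieldType) (m : nat).
Hypothesis hchar : 3 \in [pchar F].
Local Notation A := (sqfree F m).
Variable U : {vspace alg F m}.
Hypothesis hU1 : forall u, u \in U -> homog 1 u.
Let X : seq (alg F m) := vbasis U.

Let spanX : <<X>>%VS = U.
Proof. exact: span_basis (vbasisP U). Qed.

Let freeX : free X.
Proof. exact: basis_free (vbasisP U). Qed.

Let sizeX : size X = \dim U.
Proof. exact: size_tuple. Qed.

Lemma prod_eq0 (s : seq (alg F m)) :
  all (fun u => u \in U) s -> (2 * \dim U < size s)%N -> \prod_(u <- s) (u : A) = 0.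
Proof.
move=> /allP sU ss.
rewrite -(prod_span_eq0 hchar (@coord_columns F m) (X := X) (s := s)) ?sizeX //.
  by apply: eq_big_seq => u /sU/hU1/lin_coord_columns ->.
by move=> u; rewrite spanX; apply: sU.
Qed.

(** Multiplying by [u] yields products of 2n+1 elements of [U]. *)
Lemma inpow_mul_eq0 w u : inpow U (2 * \dim U) w -> u \in U -> (w : A) * u = 0.
Proof.
case=> s [sU ->] uU; rewrite mulr_suml big_seq big1 // => p ps.
rewrite -scalerAl foldr_amul mulrC.
have := @prod_eq0 (u :: p.2); rewrite big_cons /= uU size_tuple => ->; rewrite ?scaler0 //.
exact: sU.
Qed.

Lemma inpow_sqprod : inpow U (2 * \dim U) (sqprod (@coord_columns F m) X).
Proof.
have sz : size (flatten [seq [:: u; u] | u <- X]) == (2 * \dim U)%N.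
  by rewrite -sizeX; elim: X => //= x Y /eqP->; rewrite mulnS.
exists [:: (1, Tuple sz)]; split=> [p|].
  rewrite inE => /eqP-> /=; apply/allP => v /flatten_mapP[u uX].
  by rewrite !inE orbb => /eqP->; apply: vbasis_mem.
rewrite big_seq1 scale1r foldr_amul /=.
have: all (fun u => u \in U) X by apply/allP => u; apply: vbasis_mem.
elim: X => [|x Y IH] /=; first by rewrite /sqprod !big_nil.
case/andP=> /hU1 x1 /IH e.
by rewrite sqprod_cons e !big_cons lin_coord_columns // expr2 mulrA.
Qed.

Lemma lin_ideal_inIdeal k f :
  lin_ideal (@coord_columns F m) U k f -> inIdeal (fun u => u \in U) f.
Proof.
elim=> [|v g {}f vU _ _ [s [sU ->]]]; first by exists [::]; rewrite big_nil.
exists ((g, v) :: s); split=> [p|]; first by rewrite inE => /orP[/eqP->|/sU].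
by rewrite big_cons (lin_coord_columns (hU1 vU)); congr (_ + _); apply: amulC.
Qed.

Hypothesis hinf : forall s : seq F, exists x, x \notin s.
Hypothesis U0 : (0 < \dim U)%N.

Lemma ms_supp V : (V <= U)%VS -> V != 0%VS ->
  (0 < \dim V <= \dim U)%N /\ (ms U (\dim V) <= #|supp V|)%N.
Proof. by move=> VU V0; rewrite lt0n dimv_eq0 V0 dimvS // ms_le_supp. Qed.

Lemma annihilator_power k (f : alg F m) :
  (forall i, (1 <= i <= \dim U)%N -> (4 * i - 2 + 2 * k <= ms U i)%N) ->
  homog k f ->
  (forall w, inpow U (2 * \dim U) w -> amul f w = 0) <-> inIdeal (fun u => u \in U) f.
Proof.
move=> hms fk; split=> [fw|[s [sU ->]] w wU]; last first.
  rewrite -[LHS]/((_ : A) * (w : A)) mulr_suml big_seq big1 // => p /sU pU.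
  rewrite -[amul _ _]/((p.1 : A) * (p.2 : A)) -mulrA (mulrC (p.2 : A)).
  by rewrite (inpow_mul_eq0 wU pU) mulr0.
(* Homogeneity of degree [k] gives the strict bound [k.+1], for which [suppA] asks for 4i + 2(k+1) -
   4 = 4i - 2 + 2k variables in dimension i. *)
have [pA _] := @propAB F m _ hchar hinf _ (@coord_columns F m) X k.+1 erefl.
apply: (@lin_ideal_inIdeal k); rewrite -spanX; apply: pA => //.
- move=> V; rewrite spanX col_supp_coord_columns => VU V0.
  have [dV msV] := ms_supp VU V0; have := hms _ dV.
  by move: dV msV; move: (\dim V) (\dim U) (ms U _) #|_|; clear; lia.
- by move=> S /fk->.
exact/fw/inpow_sqprod.
Qed.

Lemma annihilator_space k (f : alg F m) :
  (forall i, (1 <= i <= \dim U)%N -> (4 * i - 3 + 2 * k <= ms U i)%N) ->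
  homog (2 * \dim U - 2 + k) f ->
  (forall u, u \in U -> amul f u = 0) <-> inIdeal (inpow U (2 * \dim U)) f.
Proof.
move=> hms fk; split=> [fu|[s [sU ->]] u uU]; last first.
  rewrite -[LHS]/((_ : A) * (u : A)) mulr_suml big_seq big1 // => p /sU pU.
  by rewrite -[amul _ _]/((p.1 : A) * (p.2 : A)) -mulrA (inpow_mul_eq0 pU uU) mulr0.
(* At d = 2n - 1 + k, [suppB] asks for 4i + 2d - 4n - 1 = 4i - 3 + 2k variables in dimension i. *)
have [_ pB] := @propAB F m _ hchar hinf _ (@coord_columns F m) X
  (2 * \dim U - 2 + k).+1 erefl.
have [||v|g [_ fE]] := pB freeX _ f.
- move=> V; rewrite spanX col_supp_coord_columns sizeX => VU V0.
  have [dV msV] := ms_supp VU V0; have := hms _ dV; move: U0.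
  by move: dV msV; move: (\dim V) (\dim U) (ms U _) #|_|; clear; lia.
- by move=> S /fk->.
- by rewrite spanX => vU; rewrite (lin_coord_columns (hU1 vU)); apply: fu.
exists [:: (g, sqprod (@coord_columns F m) X)]; split=> [p|].
  by rewrite inE => /eqP->; apply: inpow_sqprod.
by rewrite big_seq1 fE; apply: amulC.
Qed.

End Ideals.

Theorem theorem7 (F : fieldType) (m : nat)
  (hinf : forall s : seq F, exists x, x \notin s)
  (hchar : (3 \in [pchar F])%N)
  (U : {vspace alg F m}) (n k : nat)
  (hU1 : forall u, u \in U -> homog 1 u)
  (hdim : \dim U = n) (hn : (1 <= n)%N) :
  ((forall i, (1 <= i <= n)%N -> (4 * i - 2 + 2 * k <= ms U i)%N) ->
     forall f : alg F m, homog k f ->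
       ((forall w, inpow U (2 * n) w -> amul f w = 0) <->
        inIdeal (fun u => u \in U) f))
  /\
  ((forall i, (1 <= i <= n)%N -> (4 * i - 3 + 2 * k <= ms U i)%N) ->
     forall f : alg F m, homog (2 * n - 2 + k) f ->
       ((forall u, u \in U -> amul f u = 0) <->
        inIdeal (inpow U (2 * n)) f)).
Proof.
subst n; split=> hms f fk.
  exact: (annihilator_power hchar hU1 hinf hms fk).
exact: (annihilator_space hchar hU1 hinf hn hms fk).
Qed.
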